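(* Consider the plant $$\dot x=Ax+B_1w+B_2u,\qquad y=C_1x+D_1w,\qquad z=C_2x+D_2u,$$ with $x(t)\in\mathbb{R}^n$, $u(t)\in\mathbb{R}^m$, $y(t)\in\mathbb{R}^k$, $w(t)\in\mathbb{R}^{\bar m}$, $z(t)\in\mathbb{R}^{\bar k}$ and real matrices of corresponding sizes, where $(A,B_2)$ is stabilizable, $(C_1,A)$ is detectable, $(A,B_1)$ is controllable, $(C_2,A)$ is observable, $B_1D_1^\top=0$, $C_2^\top D_2=0$, and both $D_1D_1^\top$ and $D_2^\top D_2$ are invertible. For $K\in\mathbb{R}^{m\times n}$ and $L\in\mathbb{R}^{n\times k}$ let $\mathcal{S}_{KL}$ be the closed-loop system, with input $w$ and output $z$, formed by this plant and the controller $$\dot{\hat x}=A\hat x+B_2u+L(\hat y-y),\qquad \hat y=C_1\hat x,\qquad u=K\hat x.$$ Let $\alpha>0$, let $Q_\alpha\succ 0$ be the positive definite solution of $$Q_\alpha A+A^\top Q_\alpha+\alpha Q_\alpha-\alpha Q_\alpha B_2(D_2^\top D_2)^{-1}B_2^\top Q_\alpha+\frac1\alpha C_2^\top C_2=0,$$ and let $P_\alpha\succ 0$ be the positive definite solution of $$AP_\alpha+P_\alpha A^\top+\alpha P_\alpha-\alpha P_\alpha C_1^\top(D_1D_1^\top)^{-1}C_1P_\alpha+\frac1\alpha B_1B_1^\top=0.$$ Then the controller with $$K=-\alpha(D_2^\top D_2)^{-1}B_2^\top Q_\alpha,\qquad L=-\alpha P_\alpha C_1^\top(D_1D_1^\top)^{-1}$$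 renders $\mathcal{S}_{KL}$ stable (its state matrix is stable) and guarantees that its $\varepsilon(\alpha)$-norm possesses the smallest possible value (among all pairs of matrices in $\mathbb{R}^{m\times n}\times\mathbb{R}^{n\times k}$ for which the $\varepsilon(\alpha)$-norm of the closed-loop system is defined), which is $$\|\mathcal{S}_{KL}\|_{\varepsilon(\alpha)}=\left(\operatorname{trace}(B_1^\top Q_\alpha B_1)+\operatorname{trace}(D_2KP_\alpha K^\top D_2^\top)\right)^{1/2}=\left(\operatorname{trace}(C_2P_\alpha C_2^\top)+\operatorname{trace}(D_1^\top L^\top Q_\alpha LD_1)\right)^{1/2}.$$
   Context: A matrix is stable if all its eigenvalues have strictly negative real parts. With $e=x-\hat x$, the closed-loop system $\mathcal{S}_{KL}$ is $$\begin{bmatrix}\dot x \\ \dot e\end{bmatrix}=\begin{bmatrix}A+B_2K&-B_2K \\ 0&A+LC_1\end{bmatrix}\begin{bmatrix}x \\ e\end{bmatrix}+\begin{bmatrix}B_1 \\ B_1+LD_1\end{bmatrix}w,\qquad z=\begin{bmatrix}C_2+D_2K&-D_2K\end{bmatrix}\begin{bmatrix}x \\ e\end{bmatrix}.$$ For a system $\mathcal{S}:\ \dot\xi=\mathcal{A}\xi+\mathcal{B}w,\ z=\mathcal{C}\xi$ with input $w$ and output $z$, and $\alpha>0$, the $\varepsilon(\alpha)$-norm is defined when $\mathcal{A}+\frac\alpha2 I$ is stable (equivalently $\alpha\in(0,-2r)$, $r<0$ the largest real part of the eigenvalues of $\mathcal{A}$), by $$\|\mathcal{S}\|_{\varepsilon(\alpha)}^2:=\operatorname{trace}(\mathcal{C}P\mathcal{C}^\top)=\operatorname{trace}(\mathcal{B}^\top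 Q\mathcal{B}),$$ where $P,Q$ are the unique solutions of $\mathcal{A}P+P\mathcal{A}^\top+\alpha P+\frac1\alpha\mathcal{B}\mathcal{B}^\top=0$ and $Q\mathcal{A}+\mathcal{A}^\top Q+\alpha Q+\frac1\alpha\mathcal{C}^\top\mathcal{C}=0$. *)

(* Defs.v *)
From HB Require Import structures.
From mathcomp Require Import all_boot all_order all_algebra.
From mathcomp Require Import all_classical all_reals all_analysis.
From mathcomp Require Import complex.

Set Implicit Arguments.
Unset Strict Implicit.
Unset Printing Implicit Defensive.

Import Order.TTheory GRing.Theory Num.Theory numFieldNormedType.Exports.
Local Open Scope classical_set_scope.
Local Open Scope ring_scope.

Section Notions.
Variable R : realType.

Definition is_stable (n : nat) (A : 'M[R]_n) : Prop :=
  forall lambda : R[i],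
    eigenvalue (map_mx (real_complex R) A) lambda -> complex.Re lambda < 0.

Definition posdef (n : nat) (Q : 'M[R]_n) : Prop :=
  Q^T = Q /\ forall x : 'cV[R]_n, x != 0 -> 0 < (x^T *m Q *m x) 0 0.

(* x' = A x + B u on the whole time axis, coordinatewise, so that dimension 0
   is covered as well. *)
Definition trajectory (n m : nat) (A : 'M[R]_n) (B : 'M[R]_(n, m))
    (u : R -> 'cV[R]_m) (x : R -> 'cV[R]_n) : Prop :=
  forall (t : R) (i : 'I_n),
    is_derive t 1 (fun s => x s i 0 : R) ((A *m x t + B *m u t) i 0).

Definition stabilizable (n m : nat) (A : 'M[R]_n) (B : 'M[R]_(n, m)) : Prop :=
  exists K : 'M[R]_(m, n), is_stable (A + B *m K).

Definition detectable (n k : nat) (C : 'M[R]_(k, n)) (A : 'M[R]_n) : Prop :=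
  exists L : 'M[R]_(n, k), is_stable (A + L *m C).

(* Continuous inputs on [0, T] extend to the line, and so do the corresponding
   trajectories; only their values on [0, T] matter. *)
Definition controllable (n m : nat) (A : 'M[R]_n) (B : 'M[R]_(n, m)) : Prop :=
  forall (x0 x1 : 'cV[R]_n) (T : R), 0 < T ->
    exists (u : R -> 'cV[R]_m) (x : R -> 'cV[R]_n),
      [/\ forall i : 'I_m, continuous (fun t => u t i 0 : R),
          trajectory A B u x, x 0 = x0 & x T = x1].

(* By linearity it suffices to consider the unforced system x' = A x, which is
   [trajectory] with an input of dimension 0. *)
Definition observable (n k : nat) (C : 'M[R]_(k, n)) (A : 'M[R]_n) : Prop :=
  forall (x x' : R -> 'cV[R]_n) (T : R), 0 < T ->
    trajectory A (0 : 'M[R]_(n, 0)) (fun=> 0) x ->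
    trajectory A (0 : 'M[R]_(n, 0)) (fun=> 0) x' ->
    (forall t : R, 0 <= t <= T -> C *m x t = C *m x' t) ->
    x 0 = x' 0.

(* xi' = sysA xi + sysB w,  z = sysC xi *)
Record lin_system (q p r : nat) : Type := LinSystem {
  sysA : 'M[R]_q;
  sysB : 'M[R]_(q, p);
  sysC : 'M[R]_(r, q)
}.

Definition eps_lyapunov (q p r : nat) (alpha : R) (S : lin_system q p r)
    (P : 'M[R]_q) : Prop :=
  sysA S *m P + P *m (sysA S)^T + alpha *: P
    + alpha^-1 *: (sysB S *m (sysB S)^T) = 0.

Definition eps_norm_defined (q p r : nat) (alpha : R) (S : lin_system q p r)
    : Prop :=
  is_stable (sysA S + (alpha / 2)%:M).

(* When [eps_norm_defined alpha S] holds, [eps_lyapunov] has exactly one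
   solution, which is the one picked by [xget]; otherwise the value below has
   no meaning. *)
Definition eps_norm (q p r : nat) (alpha : R) (S : lin_system q p r) : R :=
  let P := xget 0 [set P : 'M[R]_q | eps_lyapunov alpha S P] in
  Num.sqrt (\tr (sysC S *m P *m (sysC S)^T)).

(* State (x, e) with e = x - xhat. *)
Definition closed_loop (n m k mbar kbar : nat) (A : 'M[R]_n)
    (B1 : 'M[R]_(n, mbar)) (B2 : 'M[R]_(n, m))
    (C1 : 'M[R]_(k, n)) (D1 : 'M[R]_(k, mbar))
    (C2 : 'M[R]_(kbar, n)) (D2 : 'M[R]_(kbar, m))
    (K : 'M[R]_(m, n)) (L : 'M[R]_(n, k)) : lin_system (n + n) mbar kbar :=
  LinSystem
    (block_mx (A + B2 *m K) (- (B2 *m K)) 0 (A + L *m C1))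
    (col_mx B1 (B1 + L *m D1))
    (row_mx (C2 + D2 *m K) (- (D2 *m K))).

End Notions.

(* Main.v *)
Require Import Defs.
From HB Require Import structures.
From mathcomp Require Import all_boot all_order all_algebra.
From mathcomp Require Import all_classical all_reals all_analysis.
From mathcomp Require Import complex ring lra.

Set Implicit Arguments.
Unset Strict Implicit.
Unset Printing Implicit Defensive.

Import Order.TTheory GRing.Theory Num.Theory numFieldNormedType.Exports.
Local Open Scope ring_scope.

(** Write [M] for the closed-loop state matrix shifted by [alpha / 2]. The
    [eps_norm] is then the trace of [C P C^T], where [P] solves the Lyapunov
    equation [M P + P M^T + alpha^-1 B B^T = 0], i.e. the cost of an ordinary
    LQG problem for the shifted plant; the optimality of the pair [K], [L] is
    the separation principle, here an identity between matrices.

    Completing the square with the control Riccati equation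
    ([control_cost]) gives, for every [K'] and [L'],
      cost = tr (B1^T Qa B1) + tr (D2 (U - K X) P (U - K X)^T D2^T),
    where [X] and [U] read the state [x] and the control [u] off [(x, e)].
    It remains to bound the second term by [tr (D2 K Pa K^T D2^T)]. The error
    of the optimal filter has covariance [Pa] and is uncorrelated with
    everything the controller knows, because the controller only sees the
    innovations of that filter. Algebraically ([innovation_lyapunov]), with
    [J] the column of two identities,
      P = Pi + J Pa J^T,
    where [Pi] solves a Lyapunov equation for the same [M], driven by the
    innovations. As [M] is stable, [Pi] is positive semidefinite
    ([lyapunov_tr_ge0]); as [(U - K X) J = - K], the second term is
    [tr (D2 K Pa K^T D2^T)] plus a nonnegative trace. For [K' = K] and
    [L' = L] only the block of [Pi] belonging to [e] enters that trace, and
    this block solves a homogeneous Lyapunov equation, so it vanishes.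

    Stability of the optimal loop is the usual Lyapunov argument: the Riccati
    equation is a Lyapunov equation for the closed-loop matrix
    ([riccati_lyapunov]), and an unstable mode would be an uncontrollable mode
    of [(A, B1)], or dually an unobservable one of [(C2, A)]. Both are excluded
    by explicit trajectories of the form [exp (s t) cos (w t)]
    ([controllable_hautus], [observable_hautus]). The two expressions of the
    minimum agree by testing each Riccati equation against the solution of the
    other one ([cost_duality]). *)

(** * Matrix entries *)

Section LinearEntries.
Variables (R : pzRingType) (m n : nat).
Implicit Types (A B : 'M[R]_(m, n)).

Lemma addmx_entry A B i j : (A + B) i j = A i j + B i j.
Proof. by rewrite mxE. Qed.

Lemma oppmx_entry A i j : (- A) i j = - A i j.
Proof. by rewrite mxE. Qed.

Lemma scalemx_entry (a : R) A i j : (a *: A) i j = a * A i j.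
Proof. by rewrite mxE. Qed.

Lemma zeromx_entry i j : (0 : 'M[R]_(m, n)) i j = 0.
Proof. by rewrite mxE. Qed.

End LinearEntries.

(** Rewriting with these rules leaves matrix products untouched, so that the
    entries of an identity that is linear in given products can be left to
    [ring] with those products as atoms. *)
Definition entryE :=
  (addmx_entry, oppmx_entry, scalemx_entry, zeromx_entry).

(** * Stability in terms of real pairs *)

Section RealPairs.
Variable R : realType.

(** The real and imaginary parts of [v M = (s + i w) v] for the complex row
    [v = p + i q]. *)
Definition eigenpair n (M : 'M[R]_n) (s w : R) (p q : 'rV[R]_n) : Prop :=
  p *m M = s *: p - w *: q /\ q *m M = w *: p + s *: q.

Definition complex_mx m n (p q : 'M[R]_(m, n)) : 'M[R[i]]_(m, n) :=
  \matrix_(i, j) Complex (p i j) (q i j).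

Lemma complex_mxE m n (p q : 'M[R]_(m, n)) :
  complex_mx p q = map_mx (real_complex R) p
                   + Complex 0 1 *: map_mx (real_complex R) q.
Proof. by apply/matrixP => i j; rewrite !mxE; simpc. Qed.

Lemma complex_mx_inj m n (p q p' q' : 'M[R]_(m, n)) :
  complex_mx p q = complex_mx p' q' -> p = p' /\ q = q'.
Proof.
by move=> /matrixP e; split; apply/matrixP => i j;
  move: (e i j); rewrite !mxE => -[].
Qed.

Lemma mul_complex_mx m n r (p q : 'M[R]_(m, n)) (M : 'M[R]_(n, r)) :
  complex_mx p q *m map_mx (real_complex R) M = complex_mx (p *m M) (q *m M).
Proof. by rewrite !complex_mxE mulmxDl -scalemxAl -!map_mxM. Qed.

Lemma scale_complex_mx m n (s w : R) (p q : 'M[R]_(m, n)) :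
  Complex s w *: complex_mx p q
  = complex_mx (s *: p - w *: q) (w *: p + s *: q).
Proof.
by apply/matrixP => i j; rewrite !mxE; simpc; congr Complex; rewrite addrC.
Qed.

Lemma stableP n (M : 'M[R]_n) :
  is_stable M <-> forall s w p q,
    eigenpair M s w p q -> (p != 0) || (q != 0) -> s < 0.
Proof.
split=> [stM s w p q [pM qM] nz | stM [s w] /eigenvalueP[v vM v0] /=].
- apply: (stM (Complex s w)); apply/eigenvalueP; exists (complex_mx p q).
    by rewrite mul_complex_mx pM qM scale_complex_mx.
  apply: contraTneq nz => pq0; rewrite negb_or !negbK.
  have [|-> ->] := @complex_mx_inj _ _ p q 0 0; last by rewrite eqxx.
  by rewrite pq0; apply/matrixP => i j; rewrite !mxE.
- have vE : v = complex_mx (map_mx (@complex.Re R) v) (map_mx (@complex.Im R) v).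
    by apply/matrixP => i j; rewrite !mxE; case: (v i j).
  move: vM v0; rewrite vE.
  move: (map_mx (@complex.Re R) v) (map_mx (@complex.Im R) v) => p q.
  rewrite mul_complex_mx scale_complex_mx => /complex_mx_inj pqM v0.
  apply: (stM s w p q pqM); apply: contraNT v0.
  rewrite negb_or !negbK => /andP[/eqP-> /eqP->].
  by apply/eqP/matrixP => i j; rewrite !mxE.
Qed.

Lemma eigenpair_shift n (M : 'M[R]_n) (a s w : R) p q :
  eigenpair M s w p q -> eigenpair (M + a%:M) (s + a) w p q.
Proof.
case=> pM qM; split.
  rewrite mulmxDr mul_mx_scalar pM; apply/matrixP=> i j; rewrite !entryE; ring.
rewrite mulmxDr mul_mx_scalar qM; apply/matrixP=> i j; rewrite !entryE; ring.
Qed.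

Lemma stable_shift n (M : 'M[R]_n) (a : R) :
  0 <= a -> is_stable (M + a%:M) -> is_stable M.
Proof.
move=> a0 /stableP stM; apply/stableP => s w p q Mpq nz.
have := stM _ _ _ _ (eigenpair_shift a Mpq) nz; lra.
Qed.

Lemma stable_tr n (M : 'M[R]_n) : is_stable M^T -> is_stable M.
Proof.
move=> stM z; rewrite eigenvalue_root_char => Mz; apply: stM.
rewrite eigenvalue_root_char -map_trmx /char_poly -det_tr.
rewrite [X in \det X](_ : _ = char_poly_mx (map_mx (real_complex R) M)) //.
by apply/matrixP => i j; rewrite !mxE eq_sym.
Qed.

(** A left eigenvector of a block triangular matrix restricts to one of the
    first diagonal block, unless its first part vanishes; then its second part
    is a left eigenvector of the other block. *)
Lemma stable_block n1 n2 (M1 : 'M[R]_n1) (X : 'M[R]_(n1, n2)) (M2 : 'M[R]_n2) :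
  is_stable M1 -> is_stable M2 -> is_stable (block_mx M1 X 0 M2).
Proof.
move=> /stableP st1 /stableP st2; apply/stableP => s w p q [].
rewrite -[p]hsubmxK -[q]hsubmxK; move: (lsubmx p) (rsubmx p) => p1 p2.
move: (lsubmx q) (rsubmx q) => q1 q2.
rewrite !mul_row_block !mulmx0 !addr0 !scale_row_mx !(opp_row_mx, add_row_mx).
move=> /eq_row_mx[p1M p2M] /eq_row_mx[q1M q2M] nz.
have [nz1|] := boolP ((p1 != 0) || (q1 != 0)); first exact: (st1 s w p1 q1).
rewrite negb_or !negbK => /andP[/eqP p0 /eqP q0].
apply: (st2 s w p2 q2); first by move: p2M q2M; rewrite p0 q0 !mul0mx !add0r.
apply: contraTT nz; rewrite p0 q0 !negb_or !negbK => /andP[/eqP-> /eqP->].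
by rewrite row_mx0 eqxx.
Qed.

End RealPairs.

(** * Hautus tests *)

Section Hautus.
Variable R : realType.

Lemma is_derive_mulmx_entry n m (p : 'rV[R]_n) (A : 'M[R]_n)
    (B : 'M[R]_(n, m)) u x (t : R) :
  trajectory A B u x ->
  is_derive t 1 (fun s => (p *m x s) 0 0 : R)
    ((p *m (A *m x t + B *m u t)) 0 0).
Proof.
move=> xAB; rewrite mxE.
have -> : (fun s => (p *m x s) 0 0 : R) = \sum_j (fun s => p 0 j * x s j 0).
  by apply: funext => s; rewrite mxE fct_sumE.
apply: is_derive_sum => j.
exact: (@is_deriveZ _ _ _ (fun s => x s j 0 : R) (p 0 j)).
Qed.

Lemma is_derive_fM (f g : R -> R) (t a b : R) :
  is_derive t 1 f a -> is_derive t 1 g b ->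
  is_derive t 1 (fun r => f r * g r) (a * g t + f t * b).
Proof.
move=> df dg; apply: (is_derive_eq (is_deriveM df dg)).
by rewrite addrC [_ *: a]mulrC.
Qed.

Lemma is_derive_fD (f g : R -> R) (t a b : R) :
  is_derive t 1 f a -> is_derive t 1 g b ->
  is_derive t 1 (fun r => f r + g r) (a + b).
Proof. exact: is_deriveD. Qed.

Lemma is_derive_linear_comp (f : R -> R) (c t a : R) :
  is_derive (c * t) 1 f a -> is_derive t 1 (fun r => f (c * r)) (a * c).
Proof.
move=> df; apply: (is_derive1_comp (g := fun r => c * r)) => //.
rewrite -[c in X in is_derive _ _ _ X]mulr1.
exact: (is_deriveZ (V := R) (W := R) (f := id) c).
Qed.

(** Along a solution, [exp (- 2 s t) (f^2 + g^2)] is constant. *)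
Lemma rotation_ode_unique (s w : R) (f g : R -> R) :
  (forall t, is_derive t (1 : R) f (s * f t - w * g t)) ->
  (forall t, is_derive t (1 : R) g (w * f t + s * g t)) ->
  f 0 = 0 -> g 0 = 0 -> forall t, f t = 0 /\ g t = 0.
Proof.
move=> df dg f0 g0 t.
pose h := fun t => expR (- (2 * s) * t) * (f t * f t + g t * g t).
have dh r : is_derive r (1 : R) h 0.
  have de := is_derive_linear_comp (is_derive_expR (- (2 * s) * r)).
  have df2 := is_derive_fM (df r) (df r); have dg2 := is_derive_fM (dg r) (dg r).
  apply: (is_derive_eq (is_derive_fM de (is_derive_fD df2 dg2))).
  ring.
have : h t = h 0 by apply: is_derive_0_is_cst.
rewrite /h f0 g0 !mul0r addr0 mulr0 => /eqP; rewrite mulf_eq0 gt_eqF ?expR_gt0 //=.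
rewrite paddr_eq0 -?expr2 ?sqr_ge0 // !sqrf_eq0.
by case/andP => /eqP-> /eqP->.
Qed.

(** If the left eigenvector [p + i q] annihilated [B], then [(p + i q) x] would
    evolve by itself along every trajectory, hence stay zero on those that start
    at the origin, while controllability lets them end anywhere. *)
Lemma controllable_hautus n m (A : 'M[R]_n) (B : 'M[R]_(n, m)) s w p q :
  controllable A B -> eigenpair A s w p q -> p *m B = 0 -> q *m B = 0 ->
  p = 0 /\ q = 0.
Proof.
move=> ctrl [pA qA] pB qB.
suff pq0 (y : 'cV[R]_n) : (p *m y) 0 0 = 0 /\ (q *m y) 0 0 = 0.
  by split; apply/rowP => j; have := pq0 (delta_mx j 0);
     rewrite -!colE !mxE => -[].
have [u [x [_ xAB x0 xy]]] := ctrl 0 y 1 ltr01.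
rewrite -xy.
have dp t : is_derive t (1 : R) (fun s => (p *m x s) 0 0 : R)
    (s * (p *m x t) 0 0 - w * (q *m x t) 0 0).
  apply: is_derive_eq; first exact: is_derive_mulmx_entry xAB.
  rewrite mulmxDr !mulmxA pB pA mul0mx addr0 mulmxBl -!scalemxAl.
  by rewrite !entryE.
have dq t : is_derive t (1 : R) (fun s => (q *m x s) 0 0 : R)
    (w * (p *m x t) 0 0 + s * (q *m x t) 0 0).
  apply: is_derive_eq; first exact: is_derive_mulmx_entry xAB.
  rewrite mulmxDr !mulmxA qB qA mul0mx addr0 mulmxDl -!scalemxAl.
  by rewrite !entryE.
by apply: (rotation_ode_unique dp dq); rewrite x0 mulmx0 entryE.
Qed.

(** An unobservable mode yields a trajectory with zero output that starts at
    [p]; the observability hypothesis compares it with the zero trajectory. *)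
Lemma observable_hautus n k (C : 'M[R]_(k, n)) (A : 'M[R]_n) s w p q :
  observable C A -> eigenpair A^T s w p q -> p *m C^T = 0 -> q *m C^T = 0 ->
  p = 0 /\ q = 0.
Proof.
move=> obs.
(* multiplying the eigenvector by [- i] exchanges the roles of [p] and [q] *)
suff main p' q' : eigenpair A^T s w p' q' -> p' *m C^T = 0 -> q' *m C^T = 0 ->
  p' = 0.
  move=> pqA pC qC; split; first exact: main pqA pC qC.
  apply: (main q (- p)) => //; last by rewrite mulNmx pC oppr0.
  case: pqA => pA qA; split; first by rewrite qA scalerN opprK addrC.
  by rewrite mulNmx pA scalerN opprB addrC.
move: p' q' => {}p {}q [pA qA] pC qC.
(* the real part of [exp ((s + i w) t) (p + i q)] *)
pose x t : 'cV[R]_n := expR (s * t) *: (cos (w * t) *: p^T - sin (w * t) *: q^T).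
have Cp : C *m p^T = 0 by apply: trmx_inj; rewrite trmx_mul trmxK pC trmx0.
have Cq : C *m q^T = 0 by apply: trmx_inj; rewrite trmx_mul trmxK qC trmx0.
have Ap : A *m p^T = s *: p^T - w *: q^T.
  by rewrite -[LHS]trmxK trmx_mul trmxK pA linearB /= !linearZ.
have Aq : A *m q^T = w *: p^T + s *: q^T.
  by rewrite -[LHS]trmxK trmx_mul trmxK qA linearD /= !linearZ.
have xA : trajectory A (0 : 'M[R]_(n, 0)) (fun=> 0) x.
  move=> t i; rewrite mulmx0 addr0.
  have -> : (fun r => x r i 0 : R) =
      (fun r => expR (s * r) * (cos (w * r) * p 0 i + sin (w * r) * - q 0 i)).
    by apply: funext => r; rewrite !entryE !mxE mulrN.
  have de := is_derive_linear_comp (is_derive_expR (s * t)).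
  have dc := is_derive_linear_comp (is_derive_cos (w * t)).
  have ds := is_derive_linear_comp (is_derive_sin (w * t)).
  have dp := is_derive_fM dc (is_derive_cst (p 0 i) t 1).
  have dq := is_derive_fM ds (is_derive_cst (- q 0 i) t 1).
  apply: (is_derive_eq (is_derive_fM de (is_derive_fD dp dq))).
  rewrite /x -scalemxAr mulmxBr -!scalemxAr Ap Aq !entryE !mxE.
  rewrite /cst; ring.
have x'A : trajectory A (0 : 'M[R]_(n, 0)) (fun=> 0) (fun=> 0).
  move=> t i; rewrite !mulmx0 addr0.
  rewrite (_ : (fun _ => _) = cst 0); last by apply: funext => ?; rewrite mxE.
  by rewrite mxE; exact: is_derive_cst.
have := obs x (fun=> 0) 1 ltr01 xA x'A.
rewrite /x !mulr0 expR0 cos0 sin0 scale0r subr0 !scale1r => p0.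
apply: trmx_inj; rewrite trmx0; apply: p0 => t _.
by rewrite mulmx0 -scalemxAr mulmxBr -!scalemxAr Cp Cq !scaler0 subr0 scaler0.
Qed.

End Hautus.

(** * Stability of the Riccati gain *)

Section Gain.
Variable R : realType.

Lemma gram_ge0 n m (A : 'M[R]_(m, n)) i : 0 <= (A *m A^T) i i.
Proof.
by rewrite mxE sumr_ge0 // => j _; rewrite mxE -expr2 sqr_ge0.
Qed.

Lemma row_gram_eq0 n (p : 'rV[R]_n) : (p *m p^T) 0 0 = 0 -> p = 0.
Proof.
rewrite mxE => /eqP; rewrite psumr_eq0 => [/allP p0|j _]; last first.
  by rewrite mxE -expr2 sqr_ge0.
apply/rowP => j; have := p0 j; rewrite mem_index_enum mxE -expr2 sqrf_eq0.
by move=> /(_ isT)/eqP->; rewrite mxE.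
Qed.

(** Evaluating the Lyapunov equation on an eigenpair gives
    [2 s (p P p^T + q P q^T) = - c (|p G|^2 + |q G|^2)]; the coupling terms in
    [w] cancel as [P] is symmetric. *)
Lemma lyapunov_stable n m (P M : 'M[R]_n) (G : 'M[R]_(n, m)) (c : R) :
  0 < c -> posdef P -> M *m P + P *m M^T + c *: (G *m G^T) = 0 ->
  (forall s w p q, eigenpair M s w p q -> p *m G = 0 -> q *m G = 0 ->
     p = 0 /\ q = 0) ->
  is_stable M.
Proof.
move=> c0 [Psym Ppos] MP hautus; apply/stableP => s w p q Mpq nz.
pose f (x y : 'rV[R]_n) := (x *m P *m y^T) 0 0.
have f_pos x : x != 0 -> 0 < f x x.
  by move=> x0; have := Ppos x^T; rewrite trmxK => -> //; rewrite trmx_eq0.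
have f_ge0 x : 0 <= f x x.
  by have [->|/f_pos/ltW//] := eqVneq x 0; rewrite /f !mul0mx mxE.
have f_sym x y : f x y = f y x.
  rewrite /f (_ : x *m P *m y^T = (y *m P *m x^T)^T); first by rewrite mxE.
  by rewrite !trmx_mul trmxK Psym mulmxA.
have [pM qM] := Mpq.
have entry x : f (x *m M) x + f x (x *m M) + c * ((x *m G) *m (x *m G)^T) 0 0 = 0.
  have := congr1 (fun Z => (x *m Z *m x^T) 0 0) MP.
  rewrite !(mulmxDl, mulmxDr) -scalemxAr -scalemxAl mulmx0 mul0mx !entryE.
  by rewrite /f !trmx_mul !mulmxA.
have := entry p; have := entry q; rewrite pM qM.
have fD x y z : f (x + y) z = f x z + f y z by rewrite /f !mulmxDl entryE.
have fZ a x y : f (a *: x) y = a * f x y by rewrite /f -!scalemxAl entryE.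
have fN x y : f (- x) y = - f x y by rewrite /f !mulNmx entryE.
rewrite ![f _ (_ + _)]f_sym !(fD, fN, fZ) [f q p]f_sym => eq ep.
have fpq : 0 < f p p + f q q.
  by case/orP: nz => /f_pos ?; [have := f_ge0 q | have := f_ge0 p]; lra.
have gp0 := gram_ge0 (p *m G) 0; have gq0 := gram_ge0 (q *m G) 0.
set gp := (p *m G *m _) 0 0 in ep gp0; set gq := (q *m G *m _) 0 0 in eq gq0.
have cgp : 0 <= c * gp by rewrite mulr_ge0 // ltW.
have cgq : 0 <= c * gq by rewrite mulr_ge0 // ltW.
have key : 2 * (s * (f p p + f q q)) + c * gp + c * gq = 0 by lra.
rewrite ltNge; apply/negP => s0.
have sf : 0 <= s * (f p p + f q q) by rewrite mulr_ge0 // ltW.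
have cancel_c x : c * x = 0 -> x = 0.
  by move/eqP; rewrite mulf_eq0 gt_eqF //= => /eqP.
have gp_eq0 : gp = 0 by apply: cancel_c; lra.
have gq_eq0 : gq = 0 by apply: cancel_c; lra.
have [p0 q0] := hautus _ _ _ _ Mpq (row_gram_eq0 gp_eq0) (row_gram_eq0 gq_eq0).
by move: nz; rewrite p0 q0 eqxx.
Qed.

(** With [S = P C^T N^-1 C P] and [N = D D^T], closing the loop adds [- 2 a S]
    and the noise [L D] adds [a^-1 L N L^T = a S]; together they make up the
    quadratic term of the Riccati equation. *)
Lemma riccati_lyapunov n m k (A P : 'M[R]_n) (B : 'M[R]_(n, m))
    (C : 'M[R]_(k, n)) (D : 'M[R]_(k, m)) (a : R) :
  0 < a -> P^T = P -> B *m D^T = 0 -> D *m D^T \in unitmx ->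
  A *m P + P *m A^T + a *: P
    - a *: (P *m C^T *m invmx (D *m D^T) *m C *m P)
    + a^-1 *: (B *m B^T) = 0 ->
  let L := - (a *: (P *m C^T *m invmx (D *m D^T))) in
  let M := A + L *m C + (a / 2)%:M in
  M *m P + P *m M^T + a^-1 *: ((B + L *m D) *m (B + L *m D)^T) = 0.
Proof.
move=> a0 Psym BD Nu ric /=.
set N := D *m D^T in Nu ric *; set L := - _.
have NT : N^T = N by rewrite /N trmx_mul trmxK.
have DB : D *m B^T = 0 by rewrite -[LHS]trmxK trmx_mul trmxK BD trmx0.
set S := P *m C^T *m invmx N *m C *m P in ric.
have LT : L^T = - (a *: (invmx N *m C *m P)).
  by rewrite /L !linearN !linearZ /= !trmx_mul trmx_inv NT Psym trmxK mulmxA.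
have LCP : L *m C *m P = - (a *: S).
  by rewrite /L !mulNmx -!scalemxAl.
have PCL : P *m C^T *m L^T = - (a *: S).
  by rewrite LT mulmxN -!scalemxAr !mulmxA.
have LN : L *m N = - (a *: (P *m C^T)).
  by rewrite /L mulNmx -scalemxAl mulmxKV.
have LNL : L *m N *m L^T = a ^+ 2 *: S.
  by rewrite LN mulNmx -scalemxAl PCL scalerN opprK scalerA expr2.
have noise : (B + L *m D) *m (B + L *m D)^T = B *m B^T + a ^+ 2 *: S.
  rewrite linearD /= trmx_mul !(mulmxDl, mulmxDr) !mulmxA.
  rewrite BD mul0mx -(mulmxA L D D^T) -/N LNL -(mulmxA L D B^T) DB mulmx0.
  by rewrite !addr0 add0r.
rewrite noise !linearD /= trmx_mul tr_scalar_mx !(mulmxDl, mulmxDr) !mulmxA.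
rewrite LCP PCL mul_mx_scalar mul_scalar_mx.
apply/matrixP => i j; move/matrixP/(_ i j): ric; rewrite !entryE => ric.
rewrite -[RHS]ric; field; exact: lt0r_neq0.
Qed.

(** Since [B D^T = 0] and [D D^T] is invertible, a mode not excited by
    [B + L D] is excited neither by [B] nor by [L], so output injection does not
    move it: it is an uncontrollable mode of [(A, B)]. *)
Lemma riccati_gain_stable n m k (A P : 'M[R]_n) (B : 'M[R]_(n, m))
    (C : 'M[R]_(k, n)) (D : 'M[R]_(k, m)) (a : R) :
  0 < a -> posdef P -> B *m D^T = 0 -> D *m D^T \in unitmx ->
  (forall s w p q, eigenpair A s w p q -> p *m B = 0 -> q *m B = 0 ->
     p = 0 /\ q = 0) ->
  A *m P + P *m A^T + a *: P
    - a *: (P *m C^T *m invmx (D *m D^T) *m C *m P)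
    + a^-1 *: (B *m B^T) = 0 ->
  let L := - (a *: (P *m C^T *m invmx (D *m D^T))) in
  is_stable (A + L *m C + (a / 2)%:M).
Proof.
move=> a0 Ppos BD Nu hautus ric L.
have lyap := riccati_lyapunov a0 Ppos.1 BD Nu ric.
have ai0 : 0 < a^-1 by rewrite invr_gt0.
apply: (lyapunov_stable ai0 Ppos lyap) => s w p q Mpq.
have kill x : x *m (B + L *m D) = 0 -> x *m L = 0 /\ x *m B = 0.
  rewrite mulmxDr mulmxA => xG.
  have xL : x *m L = 0.
    apply: (row_free_inj (A := D *m D^T)); first by rewrite row_free_unit.
    move/(congr1 (mulmx^~ D^T)): xG.
    by rewrite mulmxDl -mulmxA BD mulmx0 add0r !mul0mx !mulmxA.
  by split=> //; move: xG; rewrite xL mul0mx addr0.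
move=> /kill[pL pB] /kill[qL qB]; apply: (hautus (s - a / 2) w) => //.
have := eigenpair_shift (- (a / 2)) Mpq.
rewrite /eigenpair raddfN /= addrK !mulmxDr !mulmxA pL qL !mul0mx !addr0.
by [].
Qed.

End Gain.

(** * Lyapunov equations of stable matrices *)

Section ComplexLyapunov.
Variable C : numClosedFieldType.
Local Open Scope sesquilinear_scope.

Lemma adjmxM m n p (A : 'M[C]_(m, n)) (B : 'M[C]_(n, p)) :
  (A *m B)^t* = B^t* *m A^t*.
Proof. by rewrite trmx_mul map_mxM. Qed.

Lemma adjmxD m n (A B : 'M[C]_(m, n)) : (A + B)^t* = A^t* + B^t*.
Proof. by rewrite linearD map_mxD. Qed.

Lemma adjmxN m n (A : 'M[C]_(m, n)) : (- A)^t* = - A^t*.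
Proof. by rewrite linearN map_mxN. Qed.

Lemma adjmxZ m n z (A : 'M[C]_(m, n)) : (z *: A)^t* = z^* *: A^t*.
Proof. by rewrite linearZ map_mxZ. Qed.

Lemma adjmx0 m n : (0 : 'M[C]_(m, n))^t* = 0.
Proof. by rewrite trmx0 map_mx0. Qed.

Lemma adjmx_scalar n z : (z%:M : 'M[C]_n)^t* = (z^*)%:M.
Proof. by rewrite tr_scalar_mx map_scalar_mx. Qed.

Lemma adjmx_block m1 m2 n1 n2 (A : 'M[C]_(m1, n1)) (B : 'M[C]_(m1, n2))
    (D : 'M[C]_(m2, n1)) (E : 'M[C]_(m2, n2)) :
  (block_mx A B D E)^t* = block_mx (A^t*) (D^t*) (B^t*) (E^t*).
Proof. by rewrite tr_block_mx map_block_mx. Qed.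

Lemma adjmx_row m n1 n2 (A : 'M[C]_(m, n1)) (B : 'M[C]_(m, n2)) :
  (row_mx A B)^t* = col_mx (A^t*) (B^t*).
Proof. by rewrite tr_row_mx map_col_mx. Qed.

Lemma adjmx_col m1 m2 n (A : 'M[C]_(m1, n)) (B : 'M[C]_(m2, n)) :
  (col_mx A B)^t* = row_mx (A^t*) (B^t*).
Proof. by rewrite tr_col_mx map_row_mx. Qed.

Definition psdmx n (W : 'M[C]_n) : Prop :=
  forall x : 'rV[C]_n, 0 <= (x *m W *m x^t*) 0 0.

Lemma psdmxD n (V W : 'M[C]_n) : psdmx V -> psdmx W -> psdmx (V + W).
Proof.
by move=> V0 W0 x; rewrite mulmxDr mulmxDl entryE addr_ge0.
Qed.

Lemma psdmx_congr m n (F : 'M[C]_(m, n)) (W : 'M[C]_n) :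
  psdmx W -> psdmx (F *m W *m F^t*).
Proof.
by move=> W0 x; have := W0 (x *m F); rewrite adjmxM !mulmxA.
Qed.

Lemma psdmx_scalar n z : 0 <= z -> psdmx (z%:M : 'M[C]_n).
Proof.
move=> z0 x; rewrite mul_mx_scalar -scalemxAl entryE mulr_ge0 // mxE.
by rewrite sumr_ge0 // => j _; rewrite !mxE mul_conjC_ge0.
Qed.

Lemma row_adj_ge0 n (r : 'rV[C]_n) : 0 <= (r *m r^t*) 0 0.
Proof. by have := @psdmx_scalar n 1 ler01 r; rewrite mulmx1. Qed.

Lemma row_adj_eq0 n (r : 'rV[C]_n) : (r *m r^t*) 0 0 = 0 -> r = 0.
Proof.
rewrite mxE => /eqP; rewrite psumr_eq0 => [/allP r0|j _]; last first.
  by rewrite !mxE mul_conjC_ge0.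
apply/rowP => j; have := r0 j; rewrite mem_index_enum !mxE mul_conjC_eq0.
by move=> /(_ isT)/eqP.
Qed.

(** Otherwise the form would be negative at [(t, r)] for a suitable real [t], as
    it is affine in [t] with slope [2 |r|^2]. *)
Lemma psdmx_block_corner0 n (r : 'rV[C]_n) (W : 'M[C]_n) :
  psdmx (block_mx (0 : 'M[C]_1) r (r^t*) W) -> r = 0.
Proof.
move=> psdW; apply: row_adj_eq0; apply: contraTeq (row_adj_ge0 r) => s0.
have {}s0 : 0 < (r *m r^t*) 0 0 by rewrite lt0r s0 row_adj_ge0.
have psdW' : psdmx W.
  have := psdmx_congr (row_mx 0 1%:M) psdW.
  rewrite mul_row_block adjmx_row mul_row_col adjmx0 adjmx_scalar conjC1.
  by rewrite !mul0mx !mul1mx !add0r mulmx0 mulmx1 add0r.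
have := psdW' r; set v := (_ *m _ *m _) 0 0; set s := (r *m r^t*) 0 0 in s0 *.
move=> v0; pose t := - (v + 1) / (2 * s).
have tR : t^* = t.
  have vR := ger0_real v0; have sR := gtr0_real s0.
  apply: conj_Creal; apply: rpred_div; first by rewrite rpredN rpredD ?rpred1.
  by rewrite rpredM ?rpred_nat.
have := psdW (row_mx t%:M r).
rewrite mul_row_block adjmx_row mul_row_col adjmx_scalar tR mulmx0 add0r.
rewrite mul_mx_scalar mul_scalar_mx mulmxDl -scalemxAl !entryE -/s -/v.
rewrite (_ : _ + _ = -1); first by rewrite oppr_ge0 ler10.
by rewrite /t; field; rewrite lt0r_neq0.
Qed.

Lemma trig_eigenvector0 n m (A : 'M[C]_n) (Y : 'M[C]_(n, m)) z :
  is_trig_mx A -> (forall i, A i i != z) -> A *m Y = z *: Y -> Y = 0.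
Proof.
move=> trA neqz AY.
have u : A - z%:M \in unitmx.
  rewrite unitmxE det_trig; last first.
    apply/is_trig_mxP => i j ij; rewrite !entryE (is_trig_mxP trA) // mxE.
    by rewrite -val_eqE ltn_eqF //= subr0.
  by rewrite unitfE; apply/prodf_neq0 => i _; rewrite !entryE mxE eqxx subr_eq0.
by rewrite -[Y](mulKmx u) mulmxBl AY mul_scalar_mx subrr mulmx0.
Qed.

(** Induction on the size. Let [pi] be the corner of [X], [b] the rest of its
    first row and [lam] the corner of [T]. If [pi = 0], the corner and hence the
    first row of [W] vanish, and then [b] vanishes because the lower right block
    of [T] does not have the eigenvalue [- conj lam]; the remaining block of [X]
    satisfies the same hypotheses. If [pi > 0], eliminating [b] against [pi] is
    a change of basis that keeps [T] lower triangular with the same diagonal, so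
    the Schur complement of [pi] solves a Lyapunov equation of smaller size. *)
Lemma lyapunov_psd_trig n (T : 'M[C]_n) : is_trig_mx T ->
  (forall i, T i i + (T i i)^* < 0) ->
  forall X W : 'M[C]_n, X^t* = X -> W^t* = W -> psdmx W ->
    T *m X + X *m T^t* + W = 0 -> psdmx X.
Proof.
move: n T; apply: trigsqmx_ind => [_ X W _ _ _ _ x|n z c A trA IH stT].
  by rewrite (thinmx0 x) !mul0mx entryE.
have stA i : A i i + (A i i)^* < 0.
  by have := stT (rshift 1 i); rewrite block_mxEdr.
have := stT (lshift n 0); rewrite block_mxEul; rewrite [z]mx11_scalar.
move: (z 0 0) => lam {stT z}; rewrite mxE eqxx => st X W.
rewrite -[X]submxK -[W]submxK.
move: (ulsubmx X) (ursubmx X) (dlsubmx X) (drsubmx X) => P b b' Y.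
move: (ulsubmx W) (ursubmx W) (dlsubmx W) (drsubmx W) => w r r' V {X W}.
rewrite !adjmx_block => /eq_block_mx[_ _ <- hY] /eq_block_mx[hw _ <- hV] {b' r'}.
rewrite adjmx0 adjmx_scalar !mulmx_block !add_block_mx.
rewrite !(mulmx0, mul0mx, addr0, add0r, mul_scalar_mx, mul_mx_scalar).
move=> psdW; rewrite -[RHS]block_mx0 => /eq_block_mx[E11 E12 _ E22].
pose inr : 'M[C]_(1 + n, n) := col_mx 0 1%:M.
have psdV : psdmx V.
  have := psdmx_congr (inr^t*) psdW.
  rewrite trmxCK adjmx_col adjmx0 adjmx_scalar conjC1 mul_row_block mul_row_col.
  by rewrite !mul0mx !mul1mx !add0r mulmx0 mulmx1 add0r.
have w0 : 0 <= w 0 0.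
  have := psdW (row_mx 1%:M 0).
  rewrite mul_row_block adjmx_row mul_row_col adjmx0 adjmx_scalar conjC1.
  by rewrite !mul0mx !mul1mx !addr0 mulmx0 mulmx1 addr0.
have E11' : (lam + lam^* ) * P 0 0 = - w 0 0.
  have := congr1 (fun Z : 'M[C]_1 => Z 0 0) E11; rewrite !entryE -mulrDl => e.
  by apply/eqP; rewrite -addr_eq0 e.
have P0 : 0 <= P 0 0 by rewrite -(nmulr_rle0 _ st) E11' oppr_le0.
(* [X] is recovered from its corner and the Schur complement [Z] *)
have schur (b0 : 'cV[C]_n) Z : psdmx Z ->
  b = P 0 0 *: b0^t* -> Y = P 0 0 *: (b0 *m b0^t*) + Z ->
  psdmx (block_mx P b (b^t*) Y).
  move=> psdZ bE YE; pose inl : 'M[C]_(1 + n, 1) := col_mx 1%:M b0.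
  rewrite [X in psdmx X](_ : _ = inl *m (P 0 0)%:M *m inl^t*
                                + inr *m Z *m inr^t*); last first.
    rewrite /inl /inr !adjmx_col mul_mx_scalar -scalemxAl mul_col_row.
    rewrite [col_mx 0 _ *m Z]mul_col_mx mul_col_row scale_block_mx add_block_mx.
    rewrite !adjmx_scalar adjmx0 conjC1.
    rewrite !(mul0mx, mulmx0, mul1mx, mulmx1, addr0, add0r).
    rewrite scalemx1 -mx11_scalar -bE -YE bE adjmxZ trmxCK.
    by rewrite conj_Creal ?ger0_real.
  by apply: psdmxD; apply: psdmx_congr => //; exact: psdmx_scalar.
have [Pz|Pnz] := eqVneq (P 0 0) 0.
- have r0 : r = 0.
    apply: psdmx_block_corner0 (V) _; move: psdW.
    have -> // : w = 0.
    by rewrite [w]mx11_scalar -[w 0 0]opprK -E11' Pz mulr0 oppr0 raddf0.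
  have b0 : b = 0.
    rewrite -[b]trmxCK (_ : b^t* = 0) ?adjmx0 //.
    apply: (trig_eigenvector0 (z := - lam^* ) trA) => [i|].
      apply: contraTneq (stA i) => ->; rewrite rmorphN /= conjCK.
      by rewrite -opprD addrC oppr_lt0 lt_gtF.
    have := congr1 (fun Z : 'rV[C]_n => Z^t* ) E12.
    rewrite [P]mx11_scalar Pz mul_scalar_mx scale0r add0r r0 addr0 adjmxD.
    rewrite adjmxM adjmxZ trmxCK adjmx0 => e; apply/eqP.
    by rewrite scaleNr -addr_eq0 addrC e.
  apply: (schur 0 Y); last 2 first.
  + by rewrite b0 adjmx0 scaler0.
  + by rewrite mul0mx scaler0 add0r.
  apply: (IH stA Y V) => //.
  by rewrite -[RHS]E22 b0 adjmx0 mulmx0 mul0mx !add0r.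
have PR : (P 0 0)^* = P 0 0 by rewrite conj_Creal ?ger0_real.
set pi := P 0 0 in E11' P0 schur Pnz PR *.
have PVR : (pi^-1)^* = pi^-1 by rewrite conj_Creal ?rpredV ?ger0_real.
pose u : 'cV[C]_n := pi^-1 *: b^t*.
have bu : b = pi *: u^t*.
  by rewrite /u adjmxZ trmxCK PVR scalerA divff // scale1r.
clearbody u.
apply: (schur u (Y - pi *: (u *m u^t* ))) => //; last by rewrite addrC subrK.
(* the last rows of the change of basis that eliminates [b] *)
pose F : 'M[C]_(n, 1 + n) := row_mx (- u) 1%:M.
have psdF := psdmx_congr F psdW.
apply: (IH stA _ _ _ _ psdF).
- by rewrite adjmxD adjmxN adjmxZ adjmxM trmxCK hY PR.
- by rewrite !adjmxM trmxCK adjmx_block hw hV trmxCK mulmxA.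
have bA : b *m A^t* = - (lam *: b) - pi *: c^t* - r.
  have := E12; rewrite [P]mx11_scalar -/pi mul_scalar_mx => e.
  apply/matrixP => i j; move/matrixP/(_ i j): e; rewrite !entryE => e.
  by apply/eqP; rewrite -subr_eq0; apply/eqP; rewrite -[RHS]e; ring.
have uA : u^t* *m A^t* = - (lam *: u^t* ) - c^t* - pi^-1 *: r.
  have -> : u^t* = pi^-1 *: b by rewrite bu scalerA mulVf // scale1r.
  rewrite -scalemxAl bA !scalerBr scalerN !scalerA mulVf // scale1r.
  by rewrite [lam * _]mulrC.
have Au : A *m u = - (lam^* *: u) - c - pi^-1 *: r^t*.
  rewrite -[LHS]trmxCK adjmxM uA !(adjmxD, adjmxN, adjmxZ) !trmxCK.
  by rewrite PVR.
have noise : F *m block_mx w r (r^t*) V *m F^t* =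
    w 0 0 *: (u *m u^t* ) - r^t* *m u^t* - u *m r + V.
  rewrite /F adjmx_row adjmxN adjmx_scalar conjC1 mul_row_block mul_row_col.
  have uw : u *m w = w 0 0 *: u by rewrite {1}[w]mx11_scalar mul_mx_scalar.
  rewrite !mul1mx mulmx1 mulNmx uw mulmxN mulmxDl.
  by rewrite !mulNmx -scalemxAl opprD opprK !addrA.
rewrite noise mulmxBr mulmxBl -!scalemxAr -!scalemxAl mulmxA Au.
rewrite -(mulmxA u) uA !(mulmxBl, mulmxBr, mulNmx, mulmxN).
rewrite -!scalemxAl -!scalemxAr.
move: E22; rewrite bu adjmxZ trmxCK PR -!scalemxAl -!scalemxAr => /matrixP E22.
apply/matrixP => i j; have := E22 i j; rewrite !entryE => e.
have -> : w 0 0 = - ((lam + lam^* ) * pi) by rewrite E11' opprK.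
rewrite -[RHS]e; field; exact: Pnz.
Qed.

(** Reduction to the triangular case by a unitary Schur decomposition. *)
Lemma lyapunov_psd n (M X W : 'M[C]_n) :
  (forall z, eigenvalue M z -> z + z^* < 0) ->
  X^t* = X -> W^t* = W -> psdmx W ->
  M *m X + X *m M^t* + W = 0 -> psdmx X.
Proof.
move=> stM hX hW psdW lyap.
have [n0|n_gt0] := posnP n.
  move: X {stM hX hW psdW lyap}; rewrite n0 => X x.
  by rewrite (thinmx0 x) !mul0mx entryE.
have [U Uu] := Schur M n_gt0.
rewrite /similar_to conjymx // => trT.
have UU : U *m U^t* = 1%:M by apply/unitarymxP.
have UU' : U^t* *m U = 1%:M by apply: mulmx1C.
have back (Z : 'M[C]_n) : U^t* *m (U *m Z *m U^t* ) *m U = Z.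
  by rewrite !mulmxA UU' mul1mx -mulmxA UU' mulmx1.
suff psdUX : psdmx (U *m X *m U^t* ).
  by have := psdmx_congr (U^t* ) psdUX; rewrite trmxCK back.
apply: (lyapunov_psd_trig trT _ _ _ (psdmx_congr U psdW)).
- move=> i; apply: stM.
  have : eigenvalue (U *m M *m U^t* ) ((U *m M *m U^t* ) i i).
    rewrite eigenvalue_root_char char_poly_trig //.
    rewrite /root horner_prod; apply/prodf_eq0; exists i => //.
    by rewrite hornerXsubC subrr.
  move=> /eigenvalueP[v vT v0]; apply/eigenvalueP; exists (v *m U).
    have := congr1 (mulmx^~ U) vT; rewrite -scalemxAl => <-.
    by rewrite -!mulmxA UU' mulmx1 !mulmxA.
  apply: contraNneq v0 => vU0.
  by rewrite -[v]mulmx1 -UU mulmxA vU0 mul0mx.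
- by rewrite !adjmxM trmxCK hX mulmxA.
- by rewrite !adjmxM trmxCK hW mulmxA.
have := congr1 (fun Z => U *m Z *m U^t* ) lyap.
rewrite mulmx0 mul0mx => <-.
rewrite !(mulmxDl, mulmxDr) !adjmxM trmxCK; congr (_ + _ + _).
  by rewrite -!mulmxA [U^t* *m (U *m _)]mulmxA UU' mul1mx.
by rewrite -!mulmxA [U^t* *m (U *m _)]mulmxA UU' mul1mx.
Qed.

(** By polarization the sesquilinear form of [X] is antisymmetric; replacing
    [x] by ['i x] makes it symmetric as well. *)
Lemma quadratic_form_eq0 n (X : 'M[C]_n) :
  (forall x : 'rV[C]_n, (x *m X *m x^t* ) 0 0 = 0) -> X = 0.
Proof.
move=> X0; pose f (x y : 'rV[C]_n) := (x *m X *m y^t* ) 0 0.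
have fDl x y z : f (x + y) z = f x z + f y z by rewrite /f !mulmxDl entryE.
have fDr x y z : f x (y + z) = f x y + f x z.
  by rewrite /f adjmxD mulmxDr entryE.
have f_anti x y : f x y = - f y x.
  have := X0 (x + y); rewrite -/(f _ _) fDl !fDr /f !X0 add0r addr0.
  by move/eqP; rewrite addr_eq0 => /eqP.
have fi x y : f ('i *: x) y = 'i * f x y by rewrite /f -!scalemxAl entryE.
have fi' x y : f x ('i *: y) = - ('i * f x y).
  by rewrite /f adjmxZ conjCi -scalemxAr entryE mulNr.
have f0 x y : f x y = 0.
  have : 'i * f x y = - ('i * f x y).
    by have := f_anti ('i *: x) y; rewrite fi fi' opprK [f y x]f_anti mulrN.
  move/eqP; rewrite -addr_eq0 -mulr2n mulrn_eq0 /= mulf_eq0.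
  by rewrite (negPf (neq0Ci C)) => /eqP.
apply/matrixP => i j; have := f0 (delta_mx 0 i) (delta_mx 0 j).
rewrite /f -rowE (_ : (delta_mx 0 j)^t* = delta_mx j 0); last first.
  by rewrite trmx_delta map_delta_mx.
by rewrite -colE !mxE.
Qed.

(** A Hermitian solution is both positive and negative semidefinite; a general
    one is a combination of two Hermitian solutions. *)
Lemma lyapunov_eq0 n (M X : 'M[C]_n) :
  (forall z, eigenvalue M z -> z + z^* < 0) ->
  M *m X + X *m M^t* = 0 -> X = 0.
Proof.
move=> stM.
have herm H : H^t* = H -> M *m H + H *m M^t* = 0 -> H = 0.
  move=> hH eqH.
  have psd0 : psdmx (0 : 'M[C]_n) by move=> x; rewrite mulmx0 mul0mx entryE.
  have psdH : psdmx H.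
    by apply: (lyapunov_psd stM hH (adjmx0 n n) psd0); rewrite addr0.
  have psdNH : psdmx (- H).
    apply: (lyapunov_psd stM _ (adjmx0 n n) psd0); first by rewrite adjmxN hH.
    by rewrite addr0 mulmxN mulNmx -opprD eqH oppr0.
  apply: quadratic_form_eq0 => x; apply/eqP; rewrite eq_le psdH andbT.
  by have := psdNH x; rewrite mulmxN mulNmx entryE oppr_ge0.
move=> eqX.
have eqX' : M *m X^t* + X^t* *m M^t* = 0.
  have := congr1 (fun Z : 'M[C]_n => Z^t* ) eqX.
  by rewrite adjmxD !adjmxM trmxCK adjmx0 addrC.
have re : X + X^t* = 0.
  apply: herm; first by rewrite adjmxD trmxCK addrC.
  by rewrite mulmxDr mulmxDl addrACA eqX eqX' addr0.
have im : 'i *: (X - X^t* ) = 0.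
  apply: herm.
    by rewrite adjmxZ adjmxD adjmxN trmxCK conjCi scaleNr -scalerN opprB.
  rewrite -scalemxAr -scalemxAl -scalerDr mulmxBr mulmxBl addrACA eqX.
  by rewrite -opprD eqX' subr0 scaler0.
move/eqP: im; rewrite scaler_eq0 (negPf (neq0Ci C)) subr_eq0 => /eqP im.
move/eqP: re; rewrite -im -mulr2n -scaler_nat scaler_eq0 pnatr_eq0 /=.
by move/eqP.
Qed.

End ComplexLyapunov.

Section RealLyapunov.
Variable R : realType.
Local Notation rc := (map_mx (real_complex R)).
Local Open Scope sesquilinear_scope.

Lemma conjC_real (x : R) : Num.conj (real_complex R x) = real_complex R x.
Proof. by apply: conj_Creal; rewrite complex_real. Qed.

Lemma adjmx_real m n (A : 'M[R]_(m, n)) : (rc A)^t* = rc A^T.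
Proof. by apply/matrixP => i j; rewrite !mxE conjC_real. Qed.

Lemma stable_ReC n (M : 'M[R]_n) : is_stable M ->
  forall z, eigenvalue (rc M) z -> z + z^* < 0.
Proof.
move=> stM z /stM Mz.
by rewrite (addcJ z) pmulr_rlt0 ?ltr0n // ltcR.
Qed.

Lemma lyapunov_unique n (M X Y W : 'M[R]_n) : is_stable M ->
  M *m X + X *m M^T + W = 0 -> M *m Y + Y *m M^T + W = 0 -> X = Y.
Proof.
move=> /stable_ReC stM eqX eqY; apply/eqP; rewrite -subr_eq0; apply/eqP.
apply: (map_mx_inj (f := real_complex R)); rewrite map_mx0.
apply: (lyapunov_eq0 stM).
rewrite adjmx_real -!map_mxM -map_mxD mulmxBr mulmxBl addrACA -opprD.
by rewrite (addIr _ (etrans eqX (esym eqY))) subrr map_mx0.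
Qed.

(** The linear map [X |-> M X + X M^T] is injective, hence onto. *)
Lemma lyapunov_solvable n (M W : 'M[R]_n) : is_stable M ->
  exists X, M *m X + X *m M^T + W = 0.
Proof.
move=> stM; pose f := mulmx M \+ mulmxr M^T : 'M[R]_n -> 'M[R]_n.
have u : lin_mx f \in unitmx.
  rewrite -row_free_unit; apply: inj_row_free => v.
  rewrite -[v]vec_mxK mul_vec_lin => /(congr1 vec_mx); rewrite mxvecK linear0.
  move=> f0; rewrite (_ : vec_mx v = 0) ?linear0 //.
  apply: (@lyapunov_unique _ M _ _ 0 stM); rewrite addr0 //.
  by rewrite mulmx0 mul0mx addr0.
exists (vec_mx (mxvec (- W) *m invmx (lin_mx f))).
apply/eqP; rewrite addr_eq0; apply/eqP; rewrite -[LHS]/(f _).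
by apply: (can_inj mxvecK); rewrite -mul_vec_lin vec_mxK mulmxKV.
Qed.

Lemma lyapunov_sym n (M X W : 'M[R]_n) : is_stable M -> W^T = W ->
  M *m X + X *m M^T + W = 0 -> X^T = X.
Proof.
move=> stM hW eqX; apply: (lyapunov_unique stM _ eqX).
have := congr1 trmx eqX.
by rewrite !linearD /= !trmx_mul trmxK hW linear0 [X in X + _]addrC.
Qed.

(** The diagonal entries of [F X F^T] are values of the form of [X], which is
    positive semidefinite. *)
Lemma lyapunov_tr_ge0 n m r (M X : 'M[R]_n) (G : 'M[R]_(n, m)) (c : R)
    (F : 'M[R]_(r, n)) :
  is_stable M -> 0 <= c -> M *m X + X *m M^T + c *: (G *m G^T) = 0 ->
  0 <= \tr (F *m X *m F^T).
Proof.
move=> stM c0 eqX.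
have hX : X^T = X.
  apply: (lyapunov_sym stM _ eqX).
  by rewrite linearZ /= trmx_mul trmxK.
have psdX : psdmx (rc X).
  apply: (lyapunov_psd (W := rc (c *: (G *m G^T))) (stable_ReC stM)).
  - by rewrite adjmx_real hX.
  - by rewrite adjmx_real linearZ /= trmx_mul trmxK.
  - have c0' : 0 <= real_complex R c by rewrite lecR.
    have := psdmx_congr (rc G) (@psdmx_scalar _ m _ c0').
    by rewrite -map_scalar_mx adjmx_real -!map_mxM mul_mx_scalar -scalemxAl.
  by rewrite !adjmx_real -!map_mxM -!map_mxD eqX map_mx0.
rewrite sumr_ge0 // => i _.
have := psdX (rc (row i F)).
rewrite adjmx_real -!map_mxM mxE lecR -!row_mul.
suff -> : (F *m X *m F^T) i i = row i (F *m X *m (row i F)^T) 0 0 by [].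
by rewrite [RHS]mxE [LHS]mxE [RHS]mxE; apply: eq_bigr => j _; rewrite !mxE.
Qed.

End RealLyapunov.

(** * The closed-loop cost *)

Section Cost.
Variable R : realType.

Lemma eps_lyapunov_shift q p r (a : R) (S : lin_system R q p r) P :
  eps_lyapunov a S P <->
  (sysA S + (a / 2)%:M) *m P + P *m (sysA S + (a / 2)%:M)^T
    + a^-1 *: (sysB S *m (sysB S)^T) = 0.
Proof.
rewrite /eps_lyapunov; set lhs := (X in X = 0 <-> _).
set rhs := (X in _ <-> X = 0); suff -> : lhs = rhs by [].
rewrite /lhs /rhs linearD /= tr_scalar_mx mulmxDl mulmxDr.
rewrite mul_scalar_mx mul_mx_scalar.
by apply/matrixP => i j; rewrite !entryE; move: a^-1 => ainv; field.
Qed.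

Lemma eps_normE q p r (a : R) (S : lin_system R q p r) P :
  eps_norm_defined a S -> eps_lyapunov a S P ->
  eps_norm a S = Num.sqrt (\tr (sysC S *m P *m (sysC S)^T)).
Proof.
move=> stM eqP; rewrite /eps_norm (@xget_subset1 _ _ _ P) //.
move=> X Y /eps_lyapunov_shift eqX /eps_lyapunov_shift.
exact: lyapunov_unique stM eqX.
Qed.

Lemma gain_identities n m (N : 'M[R]_m) (Q : 'M[R]_n) (B : 'M[R]_(n, m))
    (a : R) :
  N \in unitmx -> N^T = N -> Q^T = Q ->
  let K := - (a *: (invmx N *m B^T *m Q)) in
  [/\ K^T = - (a *: (Q *m B *m invmx N)),
      N *m K = - (a *: (B^T *m Q)),
      K^T *m N = - (a *: (Q *m B))
    & K^T *m N *m K = a ^+ 2 *: (Q *m B *m invmx N *m B^T *m Q)].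
Proof.
move=> Nu NT QT K.
have KT : K^T = - (a *: (Q *m B *m invmx N)).
  by rewrite /K linearN linearZ /= !trmx_mul trmxK QT trmx_inv NT mulmxA.
have KN : K^T *m N = - (a *: (Q *m B)).
  by rewrite KT mulNmx -scalemxAl mulmxKV.
split=> //; first by rewrite /K mulmxN -scalemxAr -!mulmxA mulKVmx.
by rewrite KN /K mulNmx mulmxN opprK -scalemxAl -scalemxAr scalerA !mulmxA.
Qed.

(** Completion of the square. The second moments [Sg] of [x] and [Ga] of [u]
    against [x] satisfy the balance [eqSg]; pairing it with [Q], and the Riccati
    equation with [Sg], gives two scalar equations whose difference is the
    claim. *)
Lemma control_cost n m mbar kbar q (A Q : 'M[R]_n) (B1 : 'M[R]_(n, mbar))
    (B2 : 'M[R]_(n, m)) (C2 : 'M[R]_(kbar, n)) (D2 : 'M[R]_(kbar, m)) (a : R)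
    (M P : 'M[R]_q) (B : 'M[R]_(q, mbar)) (X : 'M[R]_(n, q))
    (U : 'M[R]_(m, q)) :
  0 < a -> C2^T *m D2 = 0 -> D2^T *m D2 \in unitmx -> Q^T = Q ->
  Q *m A + A^T *m Q + a *: Q
    - a *: (Q *m B2 *m invmx (D2^T *m D2) *m B2^T *m Q)
    + a^-1 *: (C2^T *m C2) = 0 ->
  X *m M = (A + (a / 2)%:M) *m X + B2 *m U -> X *m B = B1 -> P^T = P ->
  M *m P + P *m M^T + a^-1 *: (B *m B^T) = 0 ->
  let K := - (a *: (invmx (D2^T *m D2) *m B2^T *m Q)) in
  \tr ((C2 *m X + D2 *m U) *m P *m (C2 *m X + D2 *m U)^T) =
  \tr (B1^T *m Q *m B1)
  + \tr ((D2 *m (U - K *m X)) *m P *m (D2 *m (U - K *m X))^T).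
Proof.
move=> a0 CD Nu Qsym ric XM XB Psym eqP K.
(* an opaque copy of [D2^T D2], so that reassociation leaves it in one piece *)
have [N NE] : {N | N = D2^T *m D2} by exists (D2^T *m D2).
rewrite -NE in Nu ric K *.
have NT : N^T = N by rewrite NE trmx_mul trmxK.
have DC : D2^T *m C2 = 0 by rewrite -[LHS]trmxK trmx_mul trmxK CD trmx0.
set S := Q *m B2 *m invmx N *m B2^T *m Q in ric.
pose Sg := X *m P *m X^T; pose Ga := U *m P *m X^T; pose Om := U *m P *m U^T.
have GaT : X *m P *m U^T = Ga^T by rewrite !trmx_mul trmxK Psym mulmxA.
have [_ NK KN KNK] := gain_identities B2 a Nu NT Qsym.
rewrite -/K -/S in NK KN KNK.
have outer (Y : 'M[R]_m) : \tr (D2 *m Y *m D2^T) = \tr (N *m Y).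
  by rewrite mxtrace_mulC mulmxA -NE.
have costL : \tr ((C2 *m X + D2 *m U) *m P *m (C2 *m X + D2 *m U)^T) =
    \tr (C2^T *m C2 *m Sg) + \tr (N *m Om).
  rewrite linearD /= !trmx_mul !(mulmxDl, mulmxDr) !mxtraceD.
  have -> : \tr (D2 *m U *m P *m (X^T *m C2^T)) = 0.
    by rewrite mulmxA mxtrace_mulC !mulmxA CD !mul0mx mxtrace0.
  have -> : \tr (C2 *m X *m P *m (U^T *m D2^T)) = 0.
    by rewrite mulmxA mxtrace_mulC !mulmxA DC !mul0mx mxtrace0.
  rewrite addr0 add0r; congr (_ + _).
    by rewrite mulmxA mxtrace_mulC /Sg !mulmxA.
  by rewrite -outer /Om !mulmxA.
have costR : \tr ((D2 *m (U - K *m X)) *m P *m (D2 *m (U - K *m X))^T) =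
    \tr (N *m Om) + a * \tr (B2^T *m Q *m Ga^T) + a * \tr (Q *m B2 *m Ga)
    + a ^+ 2 * \tr (S *m Sg).
  rewrite trmx_mul -!(mulmxA D2) !mulmxA -(mulmxA D2 _ P) -(mulmxA D2).
  rewrite outer linearB /= trmx_mul !(mulmxBl, mulmxBr) !mulmxA.
  rewrite !raddfB /=.
  have -> : \tr (N *m K *m X *m P *m U^T) = - (a * \tr (B2^T *m Q *m Ga^T)).
    by rewrite -2!mulmxA (mulmxA X) GaT NK mulNmx -scalemxAl raddfN /= mxtraceZ.
  have -> : \tr (N *m U *m P *m X^T *m K^T) = - (a * \tr (Q *m B2 *m Ga)).
    rewrite mxtrace_mulC !mulmxA KN !mulNmx -!scalemxAl raddfN /= mxtraceZ.
    by rewrite /Ga ?mulmxA.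
  have -> : \tr (N *m K *m X *m P *m X^T *m K^T) = a ^+ 2 * \tr (S *m Sg).
    rewrite mxtrace_mulC !mulmxA KNK -!scalemxAl mxtraceZ.
    by rewrite /Sg ?mulmxA.
  rewrite /Om ?mulmxA; ring.
have eqSg : A *m Sg + Sg *m A^T + a *: Sg + B2 *m Ga + Ga^T *m B2^T
    + a^-1 *: (B1 *m B1^T) = 0.
  have : X *m M *m P *m X^T + X *m P *m (X *m M)^T + a^-1 *: (B1 *m B1^T) = 0.
    have := congr1 (fun Z => X *m Z *m X^T) eqP.
    rewrite mulmx0 mul0mx => <-; rewrite -XB !trmx_mul !(mulmxDr, mulmxDl).
    by rewrite -scalemxAr -scalemxAl !mulmxA.
  have -> : (X *m M)^T = X^T *m A^T + (a / 2) *: X^T + U^T *m B2^T.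
    by rewrite XM mulmxDl mul_scalar_mx !linearD /= linearZ /= !trmx_mul.
  have -> : X *m M = A *m X + (a / 2) *: X + B2 *m U.
    by rewrite XM mulmxDl mul_scalar_mx.
  rewrite !(mulmxDl, mulmxDr) -!scalemxAl -!scalemxAr !mulmxA GaT.
  rewrite -!(mulmxA A) -!(mulmxA B2) => e.
  apply/matrixP => i j; move/matrixP/(_ i j): e; rewrite !entryE => e.
  by rewrite -[RHS]e /Sg /Ga; move: a^-1 => ainv; field.
clearbody Sg Ga Om.
have lyap : \tr (Q *m A *m Sg) + \tr (A^T *m Q *m Sg) + a * \tr (Q *m Sg)
    + \tr (Q *m B2 *m Ga) + \tr (B2^T *m Q *m Ga^T)
    + a^-1 * \tr (B1^T *m Q *m B1) = 0.
  have := congr1 (fun Z => \tr (Q *m Z)) eqSg.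
  rewrite mulmx0 mxtrace0 !mulmxDr -!scalemxAr !mxtraceD !mxtraceZ !mulmxA.
  have -> : \tr (Q *m Sg *m A^T) = \tr (A^T *m Q *m Sg).
    by rewrite mxtrace_mulC mulmxA.
  have -> : \tr (Q *m Ga^T *m B2^T) = \tr (B2^T *m Q *m Ga^T).
    by rewrite mxtrace_mulC mulmxA.
  have -> : \tr (Q *m B1 *m B1^T) = \tr (B1^T *m Q *m B1).
    by rewrite mxtrace_mulC mulmxA.
  by [].
have ricS : \tr (Q *m A *m Sg) + \tr (A^T *m Q *m Sg) + a * \tr (Q *m Sg)
    - a * \tr (S *m Sg) + a^-1 * \tr (C2^T *m C2 *m Sg) = 0.
  have := congr1 (fun Z => \tr (Z *m Sg)) ric.
  rewrite mul0mx mxtrace0 !(mulmxDl, mulNmx) -!scalemxAl.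
  by rewrite !mxtraceD raddfN /= !mxtraceZ.
rewrite costL costR.
move: lyap ricS.
set b1 := \tr (B1^T *m _ *m _); set g1 := \tr (Q *m B2 *m _).
set g2 := \tr (B2^T *m _ *m _); set c2 := \tr (C2^T *m _ *m _).
set s1 := \tr (Q *m A *m _).
set s2 := \tr (A^T *m _ *m _).
set s3 := \tr (Q *m Sg); set s4 := \tr (S *m _); set o := \tr (N *m _).
move=> lyap ricS.
have e : a^-1 * b1 + g1 + g2 = a^-1 * c2 - a * s4 by lra.
have -> : c2 = a * (a^-1 * b1 + g1 + g2) + a ^+ 2 * s4.
  by rewrite e; field; exact: lt0r_neq0.
by field; exact: lt0r_neq0.
Qed.

(** If the plant is embedded by [J] in the larger system up to the measured
    channel [H], then [M J = J AL + F C1] and [B = J BL + F D1] with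
    [F = H - J L] and [AL], [BL] the matrices of the optimal filter error. That
    error contributes [J Pa J^T], and its correlation with the innovations
    cancels because [BL D1^T = - a Pa C1^T]. *)
Lemma innovation_lyapunov n k mbar q (A Pa : 'M[R]_n) (B1 : 'M[R]_(n, mbar))
    (C1 : 'M[R]_(k, n)) (D1 : 'M[R]_(k, mbar)) (a : R)
    (M P : 'M[R]_q) (B : 'M[R]_(q, mbar)) (J : 'M[R]_(q, n))
    (H : 'M[R]_(q, k)) :
  0 < a -> B1 *m D1^T = 0 -> D1 *m D1^T \in unitmx -> Pa^T = Pa ->
  A *m Pa + Pa *m A^T + a *: Pa
    - a *: (Pa *m C1^T *m invmx (D1 *m D1^T) *m C1 *m Pa)
    + a^-1 *: (B1 *m B1^T) = 0 ->
  M *m J = J *m (A + (a / 2)%:M) + H *m C1 -> B = J *m B1 + H *m D1 ->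
  M *m P + P *m M^T + a^-1 *: (B *m B^T) = 0 ->
  let L := - (a *: (Pa *m C1^T *m invmx (D1 *m D1^T))) in
  let Pi := P - J *m Pa *m J^T in
  let G := (H - J *m L) *m D1 in
  M *m Pi + Pi *m M^T + a^-1 *: (G *m G^T) = 0.
Proof.
move=> a0 BD Nu Psym ric MJ BE eqP L Pi G.
have := riccati_lyapunov a0 Psym BD Nu ric; cbv zeta; rewrite -/L.
have LN : L *m (D1 *m D1^T) = - (a *: (Pa *m C1^T)).
  by rewrite /L mulNmx -scalemxAl mulmxKV.
clearbody L; set AL := A + L *m C1 + _; set BL := B1 + L *m D1 => lyapL.
set F := H - J *m L in G *.
have MJ' : M *m J = J *m AL + F *m C1.
  rewrite MJ /AL /F !mulmxDr mulmxBl !mulmxA.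
  by apply/matrixP => i j; rewrite !entryE; ring.
have BE' : B = J *m BL + G.
  rewrite BE /BL /G /F mulmxDr mulmxBl !mulmxA.
  by apply/matrixP => i j; rewrite !entryE; ring.
have BLD : BL *m D1^T = - (a *: (Pa *m C1^T)).
  by rewrite /BL mulmxDl BD add0r -mulmxA LN.
have BLG : BL *m G^T = - (a *: (Pa *m C1^T *m F^T)).
  by rewrite /G trmx_mul mulmxA BLD mulNmx -scalemxAl.
clearbody G; clearbody AL BL F.
have GBL : G *m BL^T = - (a *: (F *m C1 *m Pa)).
  have := congr1 trmx BLG; rewrite trmx_mul trmxK => ->.
  by rewrite linearN linearZ /= !trmx_mul !trmxK Psym mulmxA.
have eJ : J *m AL *m Pa *m J^T + J *m Pa *m AL^T *m J^T
    + a^-1 *: (J *m BL *m BL^T *m J^T) = 0.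
  have := congr1 (fun Z => J *m Z *m J^T) lyapL.
  rewrite mulmx0 mul0mx !(mulmxDr, mulmxDl) -scalemxAr -scalemxAl.
  by rewrite !mulmxA.
have MPi : M *m Pi = M *m P - (J *m AL *m Pa *m J^T + F *m C1 *m Pa *m J^T).
  by rewrite /Pi mulmxBr !mulmxA MJ' !mulmxDl.
have PiM : Pi *m M^T =
    P *m M^T - (J *m Pa *m AL^T *m J^T + J *m Pa *m C1^T *m F^T).
  rewrite /Pi mulmxBl -(mulmxA _ J^T) -trmx_mul MJ' linearD /= !trmx_mul.
  by rewrite mulmxDr !mulmxA.
have BB : B *m B^T = J *m BL *m BL^T *m J^T
    - a *: (J *m Pa *m C1^T *m F^T) - a *: (F *m C1 *m Pa *m J^T) + G *m G^T.
  rewrite BE' linearD /= trmx_mul !(mulmxDl, mulmxDr) !mulmxA GBL.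
  rewrite -(mulmxA J BL (G^T)) BLG !(mulmxN, mulNmx) -scalemxAr -scalemxAl !mulmxA.
  by apply/matrixP => i j; rewrite !entryE; ring.
move: eqP; rewrite MPi PiM BB => eqP.
apply/matrixP => i j; move/matrixP/(_ i j): eqP; move/matrixP/(_ i j): eJ.
rewrite !entryE => eJ eqP.
rewrite -[RHS]subr0 -{1}eqP -eJ; field; exact: lt0r_neq0.
Qed.

(** Subtract the trace of [Q] times the equation of [P] from the trace of [P]
    times the equation of [Q]: the terms linear in [P] and in [Q] cancel, and
    the quadratic and constant terms make up the claim. *)
Lemma cost_duality n m k mbar kbar (A Q P : 'M[R]_n) (B1 : 'M[R]_(n, mbar))
    (B2 : 'M[R]_(n, m)) (C1 : 'M[R]_(k, n)) (D1 : 'M[R]_(k, mbar))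
    (C2 : 'M[R]_(kbar, n)) (D2 : 'M[R]_(kbar, m)) (a : R) :
  0 < a -> D1 *m D1^T \in unitmx -> D2^T *m D2 \in unitmx ->
  Q^T = Q -> P^T = P ->
  Q *m A + A^T *m Q + a *: Q
    - a *: (Q *m B2 *m invmx (D2^T *m D2) *m B2^T *m Q)
    + a^-1 *: (C2^T *m C2) = 0 ->
  A *m P + P *m A^T + a *: P
    - a *: (P *m C1^T *m invmx (D1 *m D1^T) *m C1 *m P)
    + a^-1 *: (B1 *m B1^T) = 0 ->
  let K := - (a *: (invmx (D2^T *m D2) *m B2^T *m Q)) in
  let L := - (a *: (P *m C1^T *m invmx (D1 *m D1^T))) in
  \tr (B1^T *m Q *m B1) + \tr (D2 *m K *m P *m K^T *m D2^T) =
  \tr (C2 *m P *m C2^T) + \tr (D1^T *m L^T *m Q *m L *m D1).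
Proof.
move=> a0 Nu1 Nu2 Qsym Psym ricQ ricP K L.
have NT1 : (D1 *m D1^T)^T = D1 *m D1^T by rewrite trmx_mul trmxK.
have NT2 : (D2^T *m D2)^T = D2^T *m D2 by rewrite trmx_mul trmxK.
have [_ _ _] := gain_identities B2 a Nu2 NT2 Qsym; rewrite -/K.
set S := Q *m B2 *m _ *m B2^T *m Q in ricQ * => KNK.
have [] := gain_identities C1^T a Nu1 NT1 Psym.
set K0 := - _; rewrite trmxK -/L => LT _ _.
rewrite -[K0]trmxK LT trmxK; set T := P *m C1^T *m _ *m C1 *m P in ricP * => LNL.
have trK : \tr (D2 *m K *m P *m K^T *m D2^T) = a ^+ 2 * \tr (S *m P).
  rewrite mxtrace_mulC !mulmxA mxtrace_mulC !mulmxA.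
  by rewrite -(mulmxA _ D2^T) KNK -scalemxAl mxtraceZ.
have trL : \tr (D1^T *m L^T *m Q *m L *m D1) = a ^+ 2 * \tr (T *m Q).
  rewrite mxtrace_mulC !mulmxA mxtrace_mulC !mulmxA.
  by rewrite -(mulmxA L D1) LNL -scalemxAl mxtraceZ.
rewrite trK trL {trK trL}.
have := congr1 (fun Z => \tr (Z *m P)) ricQ.
have := congr1 (fun Z => \tr (Z *m Q)) ricP.
rewrite !mul0mx mxtrace0 !(mulmxDl, mulNmx) -!scalemxAl.
rewrite !mxtraceD !raddfN /= !mxtraceZ.
have -> : \tr (C2^T *m C2 *m P) = \tr (C2 *m P *m C2^T).
  by rewrite [RHS]mxtrace_mulC mulmxA.
have -> : \tr (B1 *m B1^T *m Q) = \tr (B1^T *m Q *m B1).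
  by rewrite [RHS]mxtrace_mulC mulmxA.
have -> : \tr (A *m P *m Q) = \tr (Q *m A *m P).
  by rewrite mxtrace_mulC mulmxA.
have -> : \tr (P *m A^T *m Q) = \tr (A^T *m Q *m P).
  by rewrite -mulmxA mxtrace_mulC.
rewrite [\tr (P *m Q)]mxtrace_mulC.
move: (\tr (Q *m A *m P)) (\tr (A^T *m Q *m P)) (\tr (Q *m P)) => x y z.
set s := \tr (S *m P); set t := \tr (T *m Q).
set b := \tr (B1^T *m _ *m _); set c := \tr (C2 *m _ *m _) => eT eS.
have e : a^-1 * b - a * t = a^-1 * c - a * s by lra.
have -> : b = a * (a^-1 * b - a * t) + a ^+ 2 * t.
  by field; exact: lt0r_neq0.
by rewrite e; field; exact: lt0r_neq0.
Qed.

End Cost.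

(** * Optimality *)

Theorem theorem8 (R : realType) (n m k mbar kbar : nat)
    (A : 'M[R]_n) (B1 : 'M[R]_(n, mbar)) (B2 : 'M[R]_(n, m))
    (C1 : 'M[R]_(k, n)) (D1 : 'M[R]_(k, mbar))
    (C2 : 'M[R]_(kbar, n)) (D2 : 'M[R]_(kbar, m))
    (AB2_stabilizable : stabilizable A B2)
    (C1A_detectable : detectable C1 A)
    (AB1_controllable : controllable A B1)
    (C2A_observable : observable C2 A)
    (B1D1 : B1 *m D1^T = 0)
    (C2D2 : C2^T *m D2 = 0)
    (D1D1_inv : D1 *m D1^T \in unitmx)
    (D2D2_inv : D2^T *m D2 \in unitmx)
    (alpha : R) (alpha_gt0 : 0 < alpha)
    (Qa Pa : 'M[R]_n)
    (Qa_posdef : posdef Qa)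
    (Qa_riccati :
       Qa *m A + A^T *m Qa + alpha *: Qa
         - alpha *: (Qa *m B2 *m invmx (D2^T *m D2) *m B2^T *m Qa)
         + alpha^-1 *: (C2^T *m C2) = 0)
    (Pa_posdef : posdef Pa)
    (Pa_riccati :
       A *m Pa + Pa *m A^T + alpha *: Pa
         - alpha *: (Pa *m C1^T *m invmx (D1 *m D1^T) *m C1 *m Pa)
         + alpha^-1 *: (B1 *m B1^T) = 0) :
  let K := - (alpha *: (invmx (D2^T *m D2) *m B2^T *m Qa)) in
  let L := - (alpha *: (Pa *m C1^T *m invmx (D1 *m D1^T))) in
  let S := closed_loop A B1 B2 C1 D1 C2 D2 in
  [/\ is_stable (sysA (S K L)),
      eps_norm_defined alpha (S K L),
      forall (K' : 'M[R]_(m, n)) (L' : 'M[R]_(n, k)),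
        eps_norm_defined alpha (S K' L') ->
        eps_norm alpha (S K L) <= eps_norm alpha (S K' L'),
      eps_norm alpha (S K L) =
        Num.sqrt (\tr (B1^T *m Qa *m B1)
                  + \tr (D2 *m K *m Pa *m K^T *m D2^T))
    & eps_norm alpha (S K L) =
        Num.sqrt (\tr (C2 *m Pa *m C2^T)
                  + \tr (D1^T *m L^T *m Qa *m L *m D1))].
Proof.
move=> K L S.
have [Qsym _] := Qa_posdef; have [Psym _] := Pa_posdef.
have ai_ge0 : 0 <= alpha^-1 by rewrite invr_ge0 ltW.
have stL : is_stable (A + L *m C1 + (alpha / 2)%:M).
  apply: (riccati_gain_stable alpha_gt0 Pa_posdef B1D1 D1D1_inv _ Pa_riccati).
  by move=> s w p q; exact: controllable_hautus.
(* the dual problem, with [A^T], [C2^T], [B2^T], [D2^T] in place of [A], [B1],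
   [C1], [D1], turns the state feedback [K] into the output injection [K^T] *)
have stK : is_stable (A + B2 *m K + (alpha / 2)%:M).
  apply: stable_tr.
  have -> : (A + B2 *m K + (alpha / 2)%:M)^T
      = A^T + - (alpha *: (Qa *m B2^T^T *m invmx (D2^T *m D2^T^T))) *m B2^T
        + (alpha / 2)%:M.
    have [] := @gain_identities R _ _ (D2^T *m D2) Qa B2 alpha D2D2_inv _ Qsym.
      by rewrite trmx_mul trmxK.
    rewrite -/K => KT _ _ _.
    by rewrite !linearD /= tr_scalar_mx trmx_mul KT !trmxK.
  apply: (riccati_gain_stable (B := C2^T) alpha_gt0 Qa_posdef).
  - by rewrite trmxK.
  - by rewrite trmxK.
  - by move=> s w p q; exact: observable_hautus.
  by rewrite !trmxK [_ *m Qa + _]addrC.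
have shiftA K' L' : sysA (S K' L') + (alpha / 2)%:M =
    block_mx (A + B2 *m K' + (alpha / 2)%:M) (- (B2 *m K')) 0
             (A + L' *m C1 + (alpha / 2)%:M).
  by rewrite /= scalar_mx_block add_block_mx !addr0.
have defKL : eps_norm_defined alpha (S K L).
  by rewrite /eps_norm_defined shiftA; exact: stable_block stK stL.
pose base := \tr (B1^T *m Qa *m B1) + \tr (D2 *m K *m Pa *m K^T *m D2^T).
(* [V K'] reads the deviation [u - K x] off [(x, e)], and [G L'] is the gain
   of the innovations in [(x, e)] *)
pose V K' : 'M[R]_(m, n + n) := row_mx (K' - K) (- K').
pose G L' : 'M[R]_(n + n, mbar) := col_mx (- L) (L' - L) *m D1.
have cost K' L' : eps_norm_defined alpha (S K' L') ->
  exists Pi : 'M[R]_(n + n), let M := sysA (S K' L') + (alpha / 2)%:M in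
    M *m Pi + Pi *m M^T + alpha^-1 *: (G L' *m (G L')^T) = 0 /\
    eps_norm alpha (S K' L') =
      Num.sqrt (base + \tr ((D2 *m V K') *m Pi *m (D2 *m V K')^T)).
  move=> defS; set M := sysA _ + _.
  have [P eqP] := lyapunov_solvable
    (alpha^-1 *: (sysB (S K' L') *m (sysB (S K' L'))^T)) defS.
  pose J : 'M[R]_(n + n, n) := col_mx 1%:M 1%:M.
  pose H : 'M[R]_(n + n, k) := col_mx 0 L'.
  pose X : 'M[R]_(n, n + n) := row_mx 1%:M 0.
  pose U : 'M[R]_(m, n + n) := row_mx K' (- K').
  have HJL : H - J *m L = col_mx (- L) (L' - L).
    by rewrite mul_col_mx mul1mx opp_col_mx add_col_mx add0r.
  have UKX : U - K *m X = V K'.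
    by rewrite mul_mx_row mulmx1 mulmx0 opp_row_mx add_row_mx oppr0 addr0.
  have VJ : V K' *m J = - K.
    by rewrite mul_row_col !mulmx1 addrAC subrr add0r.
  have Csys : sysC (S K' L') = C2 *m X + D2 *m U.
    by rewrite !mul_mx_row add_row_mx mulmx1 mulmx0 add0r mulmxN.
  exists (P - J *m Pa *m J^T); split.
    rewrite /G -HJL.
    apply: (innovation_lyapunov alpha_gt0 B1D1 D1D1_inv Psym Pa_riccati _ _ eqP).
    - rewrite /M shiftA mul_block_col !mulmx1 mul_col_mx mul1mx mul_col_mx.
      rewrite add_col_mx !mul0mx !add0r; congr col_mx.
        by apply/matrixP => i j; rewrite !entryE; ring.
      by rewrite addrAC.
    by rewrite /= !mul_col_mx add_col_mx mul1mx mul0mx addr0.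
  rewrite (eps_normE defS (P := P)); last exact/eps_lyapunov_shift.
  congr Num.sqrt; rewrite Csys.
  have Psym' : P^T = P.
    by apply: (lyapunov_sym defS _ eqP); rewrite linearZ /= trmx_mul trmxK.
  have XM : X *m M = (A + (alpha / 2)%:M) *m X + B2 *m U.
    rewrite /M shiftA mul_row_block !mul_mx_row !mul1mx !mul0mx !addr0.
    by rewrite add_row_mx mulmx1 mulmx0 add0r mulmxN addrAC.
  have XB : X *m sysB (S K' L') = B1 by rewrite mul_row_col mul1mx mul0mx addr0.
  rewrite (control_cost alpha_gt0 C2D2 D2D2_inv Qsym Qa_riccati XM XB Psym' eqP).
  rewrite -/K UKX /base -addrA; congr (_ + _).
  (* hides that [K] is an opposite, which [mulmxN] would otherwise pull out *)
  clearbody K.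
  have DVJ : (D2 *m V K') *m J = - (D2 *m K) by rewrite -mulmxA VJ mulmxN.
  move: (D2 *m V K') DVJ => F FJ.
  have FJT : J^T *m F^T = - (K^T *m D2^T) 
    by rewrite -trmx_mul FJ; rewrite linearN /= trmx_mul.
  rewrite mulmxBr mulmxBl !mulmxA FJ -(mulmxA _ J^T) FJT !(mulNmx, mulmxN) opprK.
  by rewrite !mulmxA mxtraceD [\tr (- _)]raddfN /= addrCA subrr addr0.
have optKL : eps_norm alpha (S K L) = Num.sqrt base.
  have [Pi [eqPi ->]] := cost K L defKL; congr Num.sqrt.
  suff Pi22 : drsubmx Pi = 0.
    rewrite -[Pi]submxK Pi22 /V subrr mul_mx_row mulmx0 mul_row_block.
    by rewrite tr_row_mx mul_row_col !(mul0mx, mulmx0, trmx0, addr0) mxtrace0 addr0.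
  apply: (lyapunov_unique (W := 0) stL); rewrite addr0; last first.
    by rewrite mulmx0 mul0mx addr0.
  move: eqPi; rewrite shiftA /G [L - L]subrr;
  rewrite [col_mx (- L) 0 *m D1]mul_col_mx mul0mx -[Pi]submxK.
  rewrite tr_block_mx mulmx_block mulmx_block tr_col_mx mul_col_row scale_block_mx.
  rewrite !add_block_mx -[RHS]block_mx0 => /eq_block_mx[_ _ _].
  by rewrite block_mxKdr !(trmx0, mul0mx, mulmx0, scaler0, add0r, addr0).
have alpha2_ge0 : 0 <= alpha / 2 by rewrite divr_ge0 // ltW.
split.
- exact: (stable_shift alpha2_ge0 defKL).
- exact: defKL.
- move=> K' L' defS; have [Pi [eqPi ->]] := cost K' L' defS.
  rewrite optKL ler_wsqrtr // lerDl.
  exact: (lyapunov_tr_ge0 _ defS ai_ge0 eqPi).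
- exact: optKL.
rewrite optKL; congr Num.sqrt.
exact: (cost_duality alpha_gt0 D1D1_inv D2D2_inv Qsym Psym Qa_riccati Pa_riccati).
Qed.
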